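(* Consider a scalar $2\pi$-periodic Hamiltonian partial differential equation $u_t=\partial_x\frac{\delta H}{\delta u}$, $u(x+2\pi,t)=u(x,t)$, as described in the context, and assume that $u=0$ is a spectrally stable solution. Let $$\Omega(k)=\omega(k)-ck=\sum_{j=0}^N\eta_jk^{2j+1},\qquad \omega(k)=\sum_{j=0}^N\alpha_jk^{2j+1},$$ be the dispersion relation of the equation linearized about $u=0$ in a reference frame moving with velocity $c$ (so $\eta_0=\alpha_0-c$ and $\eta_j=\alpha_j$ for $j\ge1$). Then a branch of traveling wave solutions with velocity $c$ bifurcates from the trivial solution at $c=\omega(1)$. With $c=\omega(1)$, a necessary condition for a Hamiltonian–Hopf bifurcation at zero amplitude (a collision of two eigenvalues whose Fourier indices differ by a positive integer $\triangle n$), characterizing a loss of spectral stability of small-amplitude solutions on the bifurcating branch, is that the equation $$\sum_{j=0}^{N}\eta_j\,(\triangle n)^{2j+1}s_{2j+1}(\gamma)=0$$ has a root $\gamma\in[-1/4,0)$. Here the polynomials $s_m$ are defined by $s_0=2$, $s_1=1$, $s_{m+1}(\gamma)=s_m(\gamma)+\gamma s_{m-1}(\gamma)$ for $m\ge1$.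
   Context: Setting. The Hamiltonian is $H=\int_0^{2\pi}\mathcal{H}(u,u_x,\dots)\,dx$. It is assumed that $\delta H/\delta u=0$ at $u=0$ and that $H=H^0+H^1$, where $H^0=-\frac12\int_0^{2\pi}\sum_{j=0}^N\alpha_j(\partial_x^ju)^2\,dx$ is the quadratic part ($N$ a finite positive integer, $\alpha_j\in\mathbb{R}$) and $H^1$ contains the higher order terms. In the frame $x\to x-ct$ the equation is $\partial_tu=\partial_x\left(\frac{\delta H}{\delta u}+cu\right)$, and traveling waves are its stationary $2\pi$-periodic solutions. The linearization about $u=0$ is $\partial_tv=c\,\partial_xv-\sum_{j=0}^N(-1)^j\alpha_j\partial_x^{2j+1}v$. Standing assumption: a unique branch of nontrivial stationary solutions emanates from $u=0$ at $c=\omega(1)$, the value at which $\Omega(1)=0$. Eigenvalues. For a Floquet exponent $\tilde\mu\in(-1/2,1/2]$, perturbations have the form $e^{\lambda t}e^{i\tilde\mu x}\sum_{n\in\mathbb{Z}}a_ne^{inx}$. At zero amplitude the eigenvalues are $\lambda_n^{(\tilde\mu)}=-i\,\Omega(n+\tilde\mu)$, $n\in\mathbb{Z}$. The Krein signature of $\lambda_n^{(\tilde\mu)}\neq0$ is $\kappa(\lambda_n^{(\tilde\mu)})=-\operatorname{sign}\left(\frac{\Omega(n+\tilde\mu)}{n+\tilde\mu}\right)$. Hamiltonian–Hopf bifurcation at zero amplitude. This means that, for a fixed $\tilde\mu$, two eigenvalues coincide at zero amplitude at a nonzero point of the imaginary axis, $\lambda_{n_1}^{(\tilde\mu)}=\lambda_{n_2}^{(\tilde\mu)}\ne0$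 with $\triangle n=n_1-n_2>0$, and split off the imaginary axis as the amplitude of the wave increases from zero along the branch. The paper uses the standard fact from Krein signature theory that this can occur only if the two coinciding eigenvalues have opposite Krein signatures. Instabilities at the origin of the spectral plane (modulational, Benjamin–Feir) are not considered. *)

(* Defs.v *)
From HB Require Import structures.
From mathcomp Require Import all_boot all_order all_algebra.
From mathcomp Require Import all_classical all_reals all_analysis.
From mathcomp.real_closed Require Export complex.
From mathcomp Require Import ring.

Set Implicit Arguments.
Unset Strict Implicit.
Unset Printing Implicit Defensive.

Import Order.TTheory GRing.Theory Num.Theory.
Import numFieldNormedType.Exports.

Local Open Scope ring_scope.
Local Open Scope complex_scope.
Local Open Scope classical_set_scope.

Local Notation Re := complex.Re.
Local Notation Im := complex.Im.

Section Functions.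
Variable R : realType.

Definition smooth (f : R -> R) : Prop :=
  forall (k : nat) (x : R), derivable (derive1n k f) x 1.

Definition periodic2pi (f : R -> R) : Prop :=
  forall x : R, f (x + 2 * pi) = f x.

Definition smooth_periodic (f : R -> R) : Prop := smooth f /\ periodic2pi f.

Definition int_period (f : R -> R) : R :=
  Rintegral (@lebesgue_measure R) `[0, 2 * pi]%classic f.

Definition sup_norm (f : R -> R) : R := sup (range (fun x => `|f x|)).

(* Half the crest-to-trough height: on periodic functions it vanishes exactly
   at the constants. *)
Definition amplitude (f : R -> R) : R := (sup (range f) - inf (range f)) / 2.

End Functions.

Section Hamiltonian.
Variables (R : realType) (M : nat).

(* A density is a function of the jet (u, u_x, ..., u^(M)). *)
Implicit Types (h : 'rV[R]_M.+1 -> R) (u v : R -> R).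

Definition jet u (x : R) : 'rV[R]_M.+1 := \row_(j < M.+1) derive1n j u x.

Definition partial (j : 'I_M.+1) h : 'rV[R]_M.+1 -> R :=
  fun z => 'D_(delta_mx 0 j) h z.

Definition partials (s : seq 'I_M.+1) h : 'rV[R]_M.+1 -> R := foldr partial h s.

(* Differentiability of all the iterated partial derivatives at every point of
   an open set amounts to being C^oo there. *)
Definition smooth_on (U : set 'rV[R]_M.+1) h : Prop :=
  forall (s : seq 'I_M.+1) (z : 'rV[R]_M.+1), U z -> differentiable (partials s h) z.

(* Vanishing 2-jet at the origin: no constant, linear or quadratic part. *)
Definition higher_order h : Prop :=
  forall s : seq 'I_M.+1, (size s <= 2)%N -> partials s h 0 = 0.

Definition hamiltonian h u : R := int_period (fun x => h (jet u x)).

(* The Euler-Lagrange expression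
     delta H / delta u = \sum_j (- d/dx)^j (dh/du_j)(u, u_x, ..., u^(M)). *)
Definition variational_derivative h u (x : R) : R :=
  \sum_(j < M.+1) (-1) ^+ j * derive1n j (fun y => partial j h (jet u y)) x.

(* Right-hand side of  u_t = d/dx (delta H / delta u + c u). *)
Definition vector_field h (c : R) u (x : R) : R :=
  derive1 (fun y => variational_derivative h u y + c * u y) x.

Definition stationary h (c : R) u : Prop :=
  smooth_periodic u /\ forall x, vector_field h c u x = 0.

(* Gateaux derivative of the vector field at u in the direction v. The vector
   field is a local differential operator, so v need not be periodic. *)
Definition linearization h (c : R) u v (x : R) : R :=
  derive1 (fun e : R => vector_field h c (fun y => u y + e * v y) x) 0.

(* lambda is an eigenvalue with Floquet exponent mu: there is a nonzero
   eigenfunction e^{i mu x} p(x) with p smooth and 2pi-periodic. The real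
   operator [linearization] acts separately on real and imaginary parts. *)
Definition floquet_eigenvalue h (c : R) u (mu : R) (lambda : R[i]) : Prop :=
  exists p : R -> R[i],
    [/\ smooth_periodic (fun x => Re (p x)),
        smooth_periodic (fun x => Im (p x)),
        exists x, p x != 0 &
        let v := fun x => (cos (mu * x) +i* sin (mu * x)) * p x in
        forall x, lambda * v x =
          linearization h c u (fun y => Re (v y)) x
            +i* linearization h c u (fun y => Im (v y)) x].

Definition floquet_exponent (mu : R) : Prop := - (1 / 2) < mu /\ mu <= 1 / 2.

(* The spectrum of the Hamiltonian linearization is symmetric about the
   imaginary axis, so stability means that it lies on that axis. *)
Definition spectrally_stable h (c : R) u : Prop :=
  forall (mu : R) (lambda : R[i]), floquet_exponent mu ->
    floquet_eigenvalue h c u mu lambda -> Re lambda = 0.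

End Hamiltonian.

Section Dispersion.
Variables (R : realType) (N : nat) (alpha : 'I_N.+1 -> R).

Definition omega (k : R) : R := \sum_(j < N.+1) alpha j * k ^+ (2 * j + 1).

Definition Omega (c k : R) : R := omega k - c * k.

Definition eta_coef (c : R) (j : 'I_N.+1) : R :=
  if j == ord0 then alpha j - c else alpha j.

Lemma OmegaE (c k : R) :
  Omega c k = \sum_(j < N.+1) eta_coef c j * k ^+ (2 * j + 1).
Proof.
rewrite /Omega /omega !big_ord_recl /eta_coef eqxx muln0 add0n !expr1.
under [X in _ = _ + X]eq_bigr => j _ do rewrite -(inj_eq val_inj) /=.
by rewrite /=; ring.
Qed.

Definition quadratic_hamiltonian (u : R -> R) : R :=
  - (1 / 2) * int_period (fun x => \sum_(j < N.+1) alpha j * (derive1n j u x) ^+ 2).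

(* H = H^0 + H^1 near u = 0, H^1 having the density h1. Both densities need
   only be smooth on a neighbourhood of the zero jet. *)
Definition hamiltonian_splitting (M : nat) (h h1 : 'rV[R]_M.+1 -> R) : Prop :=
  exists U : set 'rV[R]_M.+1,
    [/\ open U /\ U 0, smooth_on U h, smooth_on U h1, higher_order h1 &
        forall u, smooth_periodic u -> (forall x, U (jet M u x)) ->
          hamiltonian h u = quadratic_hamiltonian u + hamiltonian h1 u].

Definition zero_eigenvalue (c mu : R) (n : int) : R[i] :=
  0 -i* Omega c (n%:~R + mu).

Definition krein_signature (c mu : R) (n : int) : R :=
  - Num.sg (Omega c (n%:~R + mu) / (n%:~R + mu)).

End Dispersion.

Section Bifurcation.
Variables (R : realType) (M : nat) (h : 'rV[R]_M.+1 -> R).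
Implicit Types (u : R -> R -> R) (c : R -> R).

(* A branch (u a, c a), 0 <= a < a0, of stationary solutions parametrized by
   amplitude, continuous for uniform convergence of all derivatives, that
   leaves the trivial solution at velocity c0. The members with a > 0 have
   positive amplitude, hence are nonconstant. *)
Definition branch_from (c0 a0 : R) u c : Prop :=
  [/\ 0 < a0, u 0 = (fun=> 0) /\ c 0 = c0,
      forall a : R, 0 <= a -> a < a0 ->
        stationary h (c a) (u a) /\ amplitude (u a) = a,
      {within `[0, a0[, continuous c} &
      forall (k : nat) (a : R), 0 <= a -> a < a0 ->
        sup_norm (derive1n k (fun x => u b x - u a x))
          @[b --> within `[0, a0[ (nbhs a)] --> (0 : R)].

(* Near (0, c0) every nonconstant stationary solution is a translate of a
   member of the branch. The mean is a Casimir of d/dx (adding a constant to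
   delta H / delta u + c u is immaterial), so that waves come in families
   indexed by the mean: uniqueness is at a given value of it. *)
Definition unique_branch_from (c0 : R) u c : Prop :=
  exists a0 : R, branch_from c0 a0 u c /\
  exists (k : nat) (e : R), 0 < e /\
    forall (w : R -> R) (s : R), stationary h s w ->
      0 < amplitude w -> `|s - c0| < e ->
      (forall j : nat, (j <= k)%N -> sup_norm (derive1n j w) < e) ->
      int_period w = int_period (u (amplitude w)) ->
      s = c (amplitude w) /\
      exists y : R, forall x, w x = u (amplitude w) (x + y).

Definition bifurcates_from_trivial (c0 : R) u c : Prop :=
  (forall s : R, stationary h s (fun=> 0)) /\
  exists a0 : R, branch_from c0 a0 u c.

Variables (N : nat) (alpha : 'I_N.+1 -> R).

(* lambda_{n1} = lambda_{n2} != 0 at zero amplitude, and this double eigenvalue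
   continues along the branch as two distinct eigenvalues, with the same
   Floquet exponent, off the imaginary axis. *)
Definition hamiltonian_hopf_at u c (mu : R) (n1 n2 : int) : Prop :=
  let l := zero_eigenvalue alpha (c 0) mu in
  [/\ floquet_exponent mu, n2 < n1, l n1 = l n2, l n1 != 0 &
      exists (e : R) (l1 l2 : R -> R[i]),
        [/\ 0 < e, l1 0 = l n1 /\ l2 0 = l n2,
            {within `[0, e[, continuous (fun a : R => Re (l1 a))} /\
            {within `[0, e[, continuous (fun a : R => Im (l1 a))},
            {within `[0, e[, continuous (fun a : R => Re (l2 a))} /\
            {within `[0, e[, continuous (fun a : R => Im (l2 a))} &
            forall a : R, 0 < a -> a < e ->
              [/\ floquet_eigenvalue h (c a) (u a) mu (l1 a),
                  floquet_eigenvalue h (c a) (u a) mu (l2 a),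
                  l1 a != l2 a, Re (l1 a) != 0 & Re (l2 a) != 0]]].

Definition hamiltonian_hopf u c (dn : nat) : Prop :=
  exists (mu : R) (n1 n2 : int),
    n1 - n2 = dn%:Z /\ hamiltonian_hopf_at u c mu n1 n2.

(* The fact from Krein signature theory: only eigenvalues of opposite
   signatures can leave the imaginary axis after a collision. *)
Definition krein_collision_principle u c : Prop :=
  forall (mu : R) (n1 n2 : int), hamiltonian_hopf_at u c mu n1 n2 ->
    krein_signature alpha (c 0) mu n1 = - krein_signature alpha (c 0) mu n2.

End Bifurcation.

Fixpoint s_poly (R : realType) (m : nat) : {poly R} :=
  match m with
  | 0 => 2%:P
  | 1 => 1
  | (m'.+1 as p).+1 => s_poly R p + 'X * s_poly R m'
  end.

(* Main.v *)
(** Two eigenvalues [-i Omega(k1) = -i Omega(k2) != 0] have opposite Krein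
    signatures only if [k1] and [k2] have opposite signs. With
    [k1 - k2 = dn], write [k1 = dn * x] and [k2 = - dn * y], where
    [x, y > 0] and [x + y = 1]. Then [gamma := - x * y] lies in [[-1/4, 0)],
    and [s_m(gamma) = x ^ m + y ^ m] since both sides satisfy the recurrence
    attached to the roots of [t ^ 2 = t + gamma]. As [Omega] is odd, the
    equation in [gamma] is exactly [Omega(k1) - Omega(k2) = 0]. *)
Require Import Defs.
From HB Require Import structures.
From mathcomp Require Import all_boot all_order all_algebra.
From mathcomp Require Import all_classical all_reals all_analysis.
From mathcomp Require Import ring lra.

Import Order.TTheory GRing.Theory Num.Theory.
Import numFieldNormedType.Exports.

Local Open Scope ring_scope.

Lemma derive1n_zero (R : realType) (k : nat) :
  derive1n k (fun=> 0 : R) = (fun=> 0 : R).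
Proof.
elim: k => [//|k IHk].
by rewrite derive1nS IHk; apply/funext => x; rewrite derive1_cst.
Qed.

Lemma smooth_periodic_zero (R : realType) : smooth_periodic (fun=> 0 : R).
Proof. by split=> [k x|x //]; rewrite derive1n_zero; exact: derivable_cst. Qed.

(** Both [delta H / delta u] and [s * u] vanish identically at [u = 0], whatever the velocity; this
    is the trivial family from which the branch bifurcates. *)
Lemma stationary_zero (R : realType) (M : nat) (h : 'rV[R]_M.+1 -> R) (s : R) :
  (forall x : R, variational_derivative h (fun=> 0) x = 0) ->
  stationary h s (fun=> 0).
Proof.
move=> hcrit; split=> [|x]; first exact: smooth_periodic_zero.
rewrite /vector_field.
under eq_fun do rewrite hcrit mulr0 addr0.
by rewrite derive1_cst.
Qed.

Lemma s_poly_power_sum (R : realType) (x y : R) (m : nat) : x + y = 1 ->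
  (s_poly R m).[- (x * y)] = x ^+ m + y ^+ m.
Proof.
(* The recurrence has order two, so the induction carries two consecutive indices. *)
move=> hxy; suff [] : (s_poly R m).[- (x * y)] = x ^+ m + y ^+ m /\
    (s_poly R m.+1).[- (x * y)] = x ^+ m.+1 + y ^+ m.+1 by [].
elim: m => [|m [IH0 IH1]]; first by rewrite /= !hornerE !expr1 !expr0 hxy.
split=> //; rewrite [s_poly R m.+2]/= !hornerE IH0 -/(s_poly R m.+1) IH1 !exprS.
have -> : y = 1 - x by rewrite -hxy addrC addKr.
ring.
Qed.

(** All exponents are odd, so [(d * y) ^ m = - (- (d * y)) ^ m] turns the power sum into a
    difference. *)
Lemma sum_eta_s_poly (R : realType) (N : nat) (alpha : 'I_N.+1 -> R)
    (c d x y : R) : x + y = 1 ->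
  \sum_(j < N.+1) eta_coef alpha c j * d ^+ (2 * j + 1)
                    * (s_poly R (2 * j + 1)).[- (x * y)]
  = Omega alpha c (d * x) - Omega alpha c (- (d * y)).
Proof.
move=> hxy; rewrite !OmegaE -sumrB; apply: eq_bigr => j _.
rewrite s_poly_power_sum // [(- _) ^+ _]exprNn -signr_odd oddD oddM /= expr1.
by rewrite !exprMn; ring.
Qed.

(** The common nonzero value of [Omega] cancels from the two signatures, leaving [sg k1 = - sg k2];
    the order [k2 < k1] then decides which is negative. *)
Lemma opposite_krein_signature (R : realType) (N : nat) (alpha : 'I_N.+1 -> R)
    (c mu : R) (n1 n2 : int) : n2 < n1 ->
  Omega alpha c (n1%:~R + mu) = Omega alpha c (n2%:~R + mu) ->
  Omega alpha c (n1%:~R + mu) != 0 ->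
  krein_signature alpha c mu n1 = - krein_signature alpha c mu n2 ->
  n2%:~R + mu < 0 < n1%:~R + mu.
Proof.
move=> n21; rewrite /krein_signature => <-.
have : n2%:~R + mu < n1%:~R + mu by rewrite ltrD2r ltr_int.
(* This excludes [k1 = 0], where the quotient in the signature would take the default value 0. *)
have Omega0 : Omega alpha c 0 = 0.
  by rewrite OmegaE big1 // => j _; rewrite addn1 expr0n mulr0.
move: (n1%:~R + mu) (n2%:~R + mu) => k1 k2 k21 W0.
have k1_neq0 : k1 != 0 by apply: contra_neq W0 => ->.
rewrite !sgrM !sgrV => /oppr_inj; rewrite -mulrN => sgk.
have {}sgk : Num.sg k1 = - Num.sg k2.
  by apply: (mulfI (x := Num.sg (Omega alpha c k1))); rewrite ?sgr_eq0.
have [k1_lt0|k1_gt0|k10] := ltgtP k1 0; last by rewrite k10 eqxx in k1_neq0.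
  have k2_lt0 : k2 < 0 by exact: lt_trans k1_lt0.
  by move: sgk; rewrite (ltr0_sg k1_lt0) (ltr0_sg k2_lt0) => ?; lra.
by rewrite andbT -sgr_lt0 -oppr_gt0 -sgk gtr0_sg.
Qed.

Theorem theorem2 (R : realType) (N : nat) (hN : (0 < N)%N)
    (alpha : 'I_N.+1 -> R) (M : nat) (h h1 : 'rV[R]_M.+1 -> R)
    (hsplit : hamiltonian_splitting alpha h h1)
    (hcrit : forall x : R, variational_derivative h (fun=> 0) x = 0)
    (c0 : R) (hc0 : Omega alpha c0 1 = 0)
    (hstable : spectrally_stable h c0 (fun=> 0))
    (u : R -> R -> R) (c : R -> R)
    (hbranch : unique_branch_from h c0 u c)
    (hkrein : krein_collision_principle h alpha u c) :
  bifurcates_from_trivial h (omega alpha 1) u c /\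
  forall dn : nat, (0 < dn)%N -> hamiltonian_hopf h alpha u c dn ->
    exists gamma : R, - (1 / 4) <= gamma /\ gamma < 0 /\
      \sum_(j < N.+1) eta_coef alpha (omega alpha 1) j * dn%:R ^+ (2 * j + 1)
                        * (s_poly R (2 * j + 1)).[gamma] = 0.
Proof.
have c0E : c0 = omega alpha 1.
  by move: hc0; rewrite /Omega mulr1 => /eqP; rewrite subr_eq0 => /eqP ->.
have [a0 [branch _]] := hbranch.
have [_ [_ c_at0] _ _ _] := branch.
rewrite -c0E; split.
  by split; [move=> s; exact: stationary_zero | exists a0].
move=> dn dn_gt0 [mu [n1 [n2 [n12 hopf]]]].
have := hkrein _ _ _ hopf.
case: hopf => _ n21 /(congr1 (@complex.Im R)) /= /oppr_inj.
rewrite c_at0 => Omega12 l_neq0 _.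
have W0 : Omega alpha c0 (n1%:~R + mu) != 0.
  by apply: contra_neq l_neq0 => W0; rewrite /zero_eigenvalue W0 oppr0.
move=> /(opposite_krein_signature _ _ _ _ _ _ _ n21 Omega12 W0) /andP[k2_lt0 k1_gt0].
have dn_neq0 : dn%:R != 0 :> R by rewrite pnatr_eq0 -lt0n.
have dn_pos : 0 < dn%:R :> R by rewrite ltr0n.
have k12 : (n1%:~R + mu) - (n2%:~R + mu) = dn%:R :> R.
  by rewrite opprD addrACA subrr addr0 -rmorphB /= n12.
pose x : R := (n1%:~R + mu) / dn%:R; pose y : R := - (n2%:~R + mu) / dn%:R.
have xy1 : x + y = 1 by rewrite -mulrDl k12 divff.
have x_gt0 : 0 < x by rewrite divr_gt0.
have y_gt0 : 0 < y by rewrite divr_gt0 // oppr_gt0.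
(* The bound [x * y <= 1/4] is [(x + y)^2 - (x - y)^2 <= 1] with [x + y = 1]. *)
exists (- (x * y)); split; first by have := sqr_ge0 (x - y); nra.
split; first by rewrite oppr_lt0 mulr_gt0.
(* Undoing the scaling by [dn] leaves [Omega(k1) - Omega(k2)]. *)
rewrite sum_eta_s_poly // mulrC divfK // mulrC divfK // opprK.
by rewrite Omega12 subrr.
Qed.
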